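(* Let $q$ be a prime power. For $3\le n<6$, the number of generic $q^n$-points of $\mathbb{P}^2(\overline{\mathbb{F}}_q)$ is \[\bigl|\mathbb{P}^2(\overline{\mathbb{F}}_q^{(n,\,\mathrm{gen})})\bigr|=\bigl|\mathbb{P}^2(\overline{\mathbb{F}}_q^{(n)})\bigr|-\bigl|\mathbb{P}^2(\mathbb{F}_q)^\vee\bigr|\cdot\bigl|\mathbb{P}^1(\overline{\mathbb{F}}_q^{(n)})\bigr|.\] For $n=6$, \[\bigl|\mathbb{P}^2(\overline{\mathbb{F}}_q^{(6,\,\mathrm{gen})})\bigr|=\bigl|\mathbb{P}^2(\overline{\mathbb{F}}_q^{(6)})\bigr|-\bigl|\mathbb{P}^2(\mathbb{F}_q)^\vee\bigr|\cdot\bigl|\mathbb{P}^1(\overline{\mathbb{F}}_q^{(6)})\bigr|-\bigl|\mathbb{P}^2(\overline{\mathbb{F}}_q^{(2)})^\vee\bigr|\cdot\bigl|\mathbb{P}^1(\overline{\mathbb{F}}_{q^2}^{(3)})\bigr|.\]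
   Context: Let $f=\mathrm{Frob}_q$ act on $\mathbb{P}^N(\overline{\mathbb{F}}_q)$ by raising coordinates to the $q$th power. A point whose $f$-orbit has exactly $n$ elements is a $q^n$-point; $\mathbb{P}^N(\overline{\mathbb{F}}_q^{(n)})$ denotes the set of $q^n$-points of $\mathbb{P}^N(\overline{\mathbb{F}}_q)$. Applying this with $q^2$ in place of $q$, $\mathbb{P}^1(\overline{\mathbb{F}}_{q^2}^{(3)})$ is the set of points of $\mathbb{P}^1(\overline{\mathbb{F}}_q)$ whose $\mathrm{Frob}_{q^2}$-orbit has exactly $3$ elements. A line $\ell\subset\mathbb{P}^2(\overline{\mathbb{F}}_q)$ whose $f$-orbit has exactly $n$ elements is a $q^n$-line. $\mathbb{P}^2(\mathbb{F}_q)^\vee$ is the set of $q$-lines ($=q^1$-lines) and $\mathbb{P}^2(\overline{\mathbb{F}}_q^{(2)})^\vee$ is the set of $q^2$-lines in $\mathbb{P}^2(\overline{\mathbb{F}}_q)$. A $q^n$-point $p\in\mathbb{P}^2(\overline{\mathbb{F}}_q)$ is generic if it does not lie on any $q^r$-line for $r<n$ when $n$ is odd, respectively for $r<n/2$ when $n$ is even. $\mathbb{P}^2(\overline{\mathbb{F}}_q^{(n,\,\mathrm{gen})})$ is the set of generic $q^n$-points. *)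

(* Defs.v *)
From HB Require Import structures.
From mathcomp Require Import all_boot all_algebra all_field.
From mathcomp Require Import generic_quotient finmap.
From mathcomp Require Import all_classical.

Set Implicit Arguments.
Unset Strict Implicit.
Unset Printing Implicit Defensive.

Import GRing.Theory.

Local Open Scope quotient_scope.
Local Open Scope classical_set_scope.
Local Open Scope card_scope.
Local Open Scope ring_scope.

Section ProjectiveSpace.

Variables (K : fieldType) (N : nat).

Definition hvec : Type := {v : 'rV[K]_N.+1 | v != 0}.
HB.instance Definition _ := Choice.on hvec.

Definition proportional (u v : hvec) : bool :=
  `[< exists2 c : K, c != 0 & val v = c *: val u >].

Lemma proportional_refl : reflexive proportional.
Proof. by move=> u; apply/asboolP; exists 1; rewrite ?oner_neq0 ?scale1r. Qed.

Lemma proportional_sym : symmetric proportional.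
Proof.
suff H u v : proportional u v -> proportional v u.
  by move=> u v; apply/idP/idP; exact: H.
move/asboolP=> [c c0 e]; apply/asboolP; exists c^-1; first by rewrite invr_eq0.
by rewrite e scalerA mulVf ?scale1r.
Qed.

Lemma proportional_trans : transitive proportional.
Proof.
move=> v u w /asboolP[c c0 e] /asboolP[d d0 e']; apply/asboolP.
by exists (d * c); rewrite ?mulf_neq0// e' e scalerA.
Qed.

Canonical proportional_equiv :=
  EquivRel proportional proportional_refl proportional_sym proportional_trans.

Definition projsp : Type := {eq_quot proportional_equiv}.
HB.instance Definition _ := EqQuotient.on projsp.
HB.instance Definition _ := Choice.on projsp.

Lemma proj_eqP (u v : hvec) :
  reflect (exists2 c : K, c != 0 & val v = c *: val u)
          (\pi_projsp u == \pi_projsp v).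
Proof. by rewrite eqmodE; exact: asboolP. Qed.

Lemma expv_neq0 (q : nat) (v : hvec) :
  map_mx (fun x : K => x ^+ q) (val v) != 0.
Proof.
case: v => v /= v0; apply: contra v0 => /eqP/rowP e; apply/eqP/rowP => i.
by have := e i; rewrite !mxE => /eqP; rewrite expf_eq0 => /andP[_ /eqP].
Qed.

Definition frob_hvec (q : nat) (v : hvec) : hvec := exist (fun w : 'rV[K]_N.+1 => w != 0) _ (expv_neq0 q v).

Definition frob (q : nat) (p : projsp) : projsp := \pi_projsp (frob_hvec q (repr p)).

Lemma frob_pi (q : nat) (v : hvec) :
  frob q (\pi_projsp v) = \pi_projsp (frob_hvec q v).
Proof.
apply/eqP/proj_eqP.
have /proj_eqP[c c0 e] : \pi_projsp (repr (\pi_projsp v)) == \pi_projsp v.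
  by rewrite reprK.
exists (c ^+ q); first by rewrite expf_neq0.
by apply/rowP => i; rewrite /= !mxE e mxE exprMn.
Qed.

End ProjectiveSpace.

(* Frob_q is a bijection with finite orbits on the points and lines considered
   here, so its forward orbits are its orbits. *)
Definition forward_orbit (T : Type) (g : T -> T) (x : T) : set T :=
  [set iter k g x | k in [set: nat]].

Definition has_orbit_size (T : Type) (g : T -> T) (n : nat) (x : T) : Prop :=
  forward_orbit g x #= `I_n.

Section Points.

Variable K : fieldType.

Definition qpoints (N q n : nat) : set (projsp K N) :=
  [set p | has_orbit_size (frob q) n p].

(* The choice of homogeneous coordinates [repr p] is irrelevant: [line_of_pi]. *)
Definition line_of (a : 'rV[K]_3) : set (projsp K 2) :=
  [set p : projsp K 2 | \sum_(i < 3) a 0 i * (val (repr p) : 'rV[K]_3) 0 i = 0].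

Lemma line_of_pi (a : 'rV[K]_3) (v : hvec K 2) :
  line_of a (\pi_(projsp K 2) v) <-> \sum_(i < 3) a 0 i * (val v : 'rV[K]_3) 0 i = 0.
Proof.
have /proj_eqP[c c0 e] : \pi_(projsp K 2) (repr (\pi_(projsp K 2) v)) == \pi_(projsp K 2) v.
  by rewrite reprK.
rewrite /line_of /= e.
under [X in _ <-> X = 0]eq_bigr => i _ do rewrite mxE mulrCA.
rewrite -mulr_sumr; split=> [->|/eqP]; first by rewrite mulr0.
by rewrite mulf_eq0 (negPf c0) => /eqP.
Qed.

Definition is_line (l : set (projsp K 2)) : Prop :=
  exists2 a : 'rV[K]_3, a != 0 & l = line_of a.

Definition qlines (q n : nat) : set (set (projsp K 2)) :=
  [set l | is_line l /\ has_orbit_size (fun m => frob q @` m) n l].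

(* For r = 0 the condition is void, an orbit being nonempty. *)
Definition qgeneric (q n : nat) : set (projsp K 2) :=
  [set p | qpoints q n p /\
    forall (r : nat) (l : set (projsp K 2)),
      (r < if odd n then n else n./2)%N -> qlines q r l -> ~ l p].

End Points.

Arguments qpoints : clear implicits.
Arguments qlines : clear implicits.
Arguments qgeneric : clear implicits.

(* Only meaningful for finite A: fset_set sends an infinite set to fset0. All
   the sets counted below are finite when q is a power of the characteristic
   of K and q > 1. *)
Definition ncard (T : choiceType) (A : set T) : nat := #|` fset_set A |%N.

(* Main.v *)
Require Import Defs.
From mathcomp Require Import all_boot all_order all_algebra all_field.
From mathcomp Require Import generic_quotient finmap.
From mathcomp Require Import all_classical.

(* Write f for Frob_q. A q^r-line l carrying a q^n-point x with r coprime to n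
   is a q-line: some power of f^r maps x to f(x), so l and f(l) share the two
   distinct points f(x) and f^(r+1)(x). Hence for n < 6 the non-generic
   q^n-points are those on q-lines, and for n = 6 those on q-lines or q^2-lines.
   All these lines are fixed by f (by f^2 if n = 6), and two of them meet in at
   most one point, which is then fixed too, so a q^n-point lies on at most one
   of them. A q^r-line has an equation with coefficients in F_{q^r}, hence is
   isomorphic to P^1 compatibly with f^r; its q^n-points therefore correspond to
   the q^n-points of P^1 when r = 1, and to the (q^2)^3-points when r = 2, n = 6
   (an f^2-orbit of size 3 on such a line cannot be an f-orbit of size 3). *)

Set Implicit Arguments.
Unset Strict Implicit.
Unset Printing Implicit Defensive.

Import GRing.Theory.

Local Open Scope classical_set_scope.
Local Open Scope ring_scope.

(** * Cardinalities and orbits *)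

Lemma ncard_setX (T U : choiceType) (A : set T) (B : set U) :
  finite_set A -> finite_set B -> ncard (A `*` B) = (ncard A * ncard B)%N.
Proof.
move=> fA fB; rewrite /ncard fset_setX// card_fset_sum1 big_imfset2 /=.
  rewrite card_fset_sum1 big_distrl /=; apply: eq_bigr => i _.
  by rewrite -card_fset_sum1 mul1n.
by move=> [? ?] [? ?] _ _ /= [-> ->].
Qed.

Lemma ncard_image (T U : choiceType) (f : T -> U) (A : set T) :
  finite_set A -> {in A &, injective f} -> ncard (f @` A) = ncard A.
Proof.
move=> fA fI; apply/fcard_eq => //; first exact: finite_image.
exact: inj_card_eq.
Qed.

Lemma ncard_setDS (T : choiceType) (A B : set T) :
  finite_set A -> B `<=` A ->
  (ncard (A `\` B))%:Z = (ncard A)%:Z - (ncard B)%:Z.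
Proof.
move=> fA sBA; have fB := sub_finite_set sBA fA.
rewrite /ncard fset_setD// cardfsDS -?fset_set_sub// subzn//.
by rewrite fsubset_leq_card// -fset_set_sub.
Qed.

Lemma ncard_setU_disj (T : choiceType) (A B : set T) :
  finite_set A -> finite_set B -> (forall x, A x -> ~ B x) ->
  ncard (A `|` B) = (ncard A + ncard B)%N.
Proof.
move=> fA fB dAB; rewrite /ncard fset_setU// cardfsU -fset_setI//.
suff -> : A `&` B = set0 by rewrite fset_set0 cardfs0 subn0.
by rewrite -subset0 => x [/dAB].
Qed.

Lemma ncard_fibered (L P U : choiceType) (S : set L) (A : set P)
    (m : L -> P -> U) (B : set U) (F : L -> set U) :
  finite_set S -> finite_set A ->
  (forall l, S l -> {in A &, injective (m l)}) ->
  (forall l, S l -> m l @` A = F l) ->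
  (forall l l' x, S l -> S l' -> F l x -> F l' x -> l = l') ->
  B = \bigcup_(l in S) F l ->
  ncard B = (ncard S * ncard A)%N.
Proof.
move=> fS fA mI mF FI ->; rewrite -ncard_setX//.
have -> : \bigcup_(l in S) F l = (fun x => m x.1 x.2) @` (S `*` A).
  apply/seteqP; split=> [u [l Sl]|u [[l a] [/= Sl Aa] <-]].
    by rewrite -mF// => -[a Aa <-]; exists (l, a).
  by exists l => //; rewrite -mF//; exists a.
rewrite ncard_image//; first exact: finite_setX.
move=> [l a] [l' a']; rewrite !inE => -[/= Sl Aa] [/= Sl' Aa'] e.
have el : l = l'.
  apply: (FI _ _ (m l a)) => //.
    by rewrite -mF//; exists a.
  by rewrite e -mF//; exists a'.
by subst l'; congr pair; apply: (mI l) => //; rewrite inE.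
Qed.

Section OrbitSize.
Variables (T : Type) (g : T -> T).
Hypothesis g_inj : injective g.

Lemma iter_inj k : injective (iter k g).
Proof. by elim: k => [//|k IH] x y /= /g_inj/IH. Qed.

Lemma iter_mul_fixed k m x : iter k g x = x -> iter (m * k) g x = x.
Proof. by move=> e; elim: m => [//|m IH]; rewrite mulSn iterD IH. Qed.

Lemma iter_eq_sub i j x : (i <= j)%N ->
  iter i g x = iter j g x -> iter (j - i) g x = x.
Proof. by move=> ij; rewrite -{1}(subnKC ij) iterD => /iter_inj/esym. Qed.

Lemma orbit_size_min_period n x : (0 < n)%N -> iter n g x = x ->
  (forall m, (0 < m < n)%N -> iter m g x <> x) -> has_orbit_size g n x.
Proof.
move=> n0 e h; rewrite /has_orbit_size.
have -> : forward_orbit g x = (fun k => iter k g x) @` `I_n.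
  apply/seteqP; split=> _ [k _ <-]; last by exists k.
  exists (k %% n)%N; first exact: ltn_pmod.
  by rewrite [in RHS](divn_eq k n) addnC iterD iter_mul_fixed.
apply: inj_card_eq => i j.
wlog ij : i j / (i <= j)%N.
  by case: (leqP i j) => [|/ltnW] ij H Hi Hj E; [exact: H|apply/esym/H].
rewrite !inE /= => ni nj /(iter_eq_sub ij) E; apply/eqP; rewrite eqn_leq ij /=.
rewrite -subn_eq0; case: posnP => // p0.
by case: (h (j - i)%N) => //; rewrite p0 (leq_ltn_trans (leq_subr _ _) nj).
Qed.

Lemma orbit_sizeP n x : has_orbit_size g n x <->
  [/\ (0 < n)%N, iter n g x = x &
      forall m, (0 < m < n)%N -> iter m g x <> x].
Proof.
split=> [H|[]]; last exact: orbit_size_min_period.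
have exP : exists m, (0 < m)%N && `[< iter m g x = x >].
  apply: contrapT => nP; apply: infinite_nat.
  have fO : finite_set (forward_orbit g x) by apply/finite_setP; exists n.
  suff /inj_card_eq/eq_finite_set <- :
    {in [set: nat] &, injective (fun k => iter k g x)} by exact: fO.
  move=> i j _ _; wlog ij : i j / (i < j)%N.
    move=> W E; case: (ltngtP i j) => // ij; first exact: W.
    by apply/esym/W.
  move=> /(iter_eq_sub (ltnW ij)) E; case: nP; exists (j - i)%N.
  by rewrite subn_gt0 ij; apply/asboolP.
case: (ex_minnP exP) => m /andP[m0 /asboolP e] hmin.
have lt k : (0 < k < m)%N -> iter k g x <> x.
  move=> /andP[k0 km] ek; have := hmin k.
  by rewrite k0 leqNgt km; move/(_ (asboolT ek)).
have Hm := orbit_size_min_period m0 e lt.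
suff -> : n = m by [].
by apply/card_eq_II; rewrite -(card_eqr Hm) card_eq_sym.
Qed.

Lemma iter_coprime k n x : (0 < k)%N -> coprime k n -> iter n g x = x ->
  exists j, iter (j * k) g x = g x.
Proof.
move=> k0 ckn e; have /(coprimeP n k0)[[u v] /= uv] := ckn.
exists u; have -> : (u * k = 1 + v * n)%N.
  by apply/eqP; rewrite -uv subnK// ltnW// -subn_gt0 uv.
by rewrite iterD iter_mul_fixed.
Qed.

End OrbitSize.

(** * Points and lines in coordinates *)

Section Coordinates.
Variables (K : fieldType) (N : nat).
Implicit Types (v w : 'rV[K]_N.+1) (x : projsp K N).

Definition pt v (v0 : v != 0) : projsp K N :=
  (\pi_(projsp K N) (exist (fun w => w != 0) v v0 : hvec K N))%qT.

Lemma ptP v w (v0 : v != 0) (w0 : w != 0) :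
  pt v0 = pt w0 <-> exists2 c, c != 0 & w = c *: v.
Proof. by split=> [/eqP/proj_eqP|H]; [|apply/eqP/proj_eqP]. Qed.

Lemma pt_ind (P : projsp K N -> Prop) :
  (forall v (v0 : v != 0), P (pt v0)) -> forall x, P x.
Proof. by move=> H x; rewrite -[x]reprK; case: (repr x) => v v0; apply: H. Qed.

Definition expmx q v := map_mx (fun x : K => x ^+ q) v.

Lemma expmx_neq0 q v : v != 0 -> expmx q v != 0.
Proof. by move=> v0; apply: (expv_neq0 q (exist _ v v0 : hvec K N)). Qed.

Lemma frob_pt q v (v0 : v != 0) : frob q (pt v0) = pt (expmx_neq0 q v0).
Proof.
rewrite /pt frob_pi; apply/eqP/proj_eqP.
by exists 1; rewrite ?oner_neq0 ?scale1r.
Qed.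

Lemma iter_frob q m x : iter m (frob q) x = frob (q ^ m) x.
Proof.
elim: m => [|m IH] /=.
  elim/pt_ind: x => v v0; rewrite frob_pt; apply/ptP.
  exists 1; rewrite ?oner_neq0//.
  by apply/rowP => i; rewrite !mxE mul1r.
rewrite IH; elim/pt_ind: x {IH} => v v0; rewrite !frob_pt; apply/ptP.
exists 1; rewrite ?oner_neq0//.
by apply/rowP => i; rewrite !mxE mul1r -exprM expnS mulnC.
Qed.

Lemma frob_fixed_pt q x : frob q x = x ->
  exists v (v0 : v != 0), [/\ x = pt v0, expmx q v = v & exists i, v 0 i = 1].
Proof.
elim/pt_ind: x => v v0 /[!frob_pt]/esym/ptP[c c0 e].
have [i vi0] : exists i, v 0 i != 0 by apply/rV0Pn.
have ci : (v 0 i) ^+ q = c * v 0 i by have /rowP/(_ i) := e; rewrite !mxE.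
have w0 : (v 0 i)^-1 *: v != 0 by rewrite scaler_eq0 invr_eq0 (negPf vi0).
exists _, w0; split.
- by apply/ptP; exists (v 0 i)^-1; rewrite ?invr_eq0.
- apply/rowP => j; rewrite !mxE exprMn exprVn ci.
  have /rowP/(_ j) := e; rewrite !mxE => ->.
  by rewrite invfM mulrACA mulVf// mul1r.
- by exists i; rewrite mxE mulVf.
Qed.

End Coordinates.

Lemma const_mx1_neq0 (R : nzRingType) n : const_mx 1 != 0 :> 'rV[R]_n.+1.
Proof. by apply/eqP => /rowP/(_ ord0) /eqP; rewrite !mxE oner_eq0. Qed.

Lemma finite_frob_fixed (K : closedFieldType) N q : (1 < q)%N ->
  finite_set [set x : projsp K N | frob q x = x].
Proof.
move=> q1.
have [s rs] : exists s : seq K, forall x, x ^+ q = x -> x \in s.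
  have P0 : 'X^q - 'X != 0 :> {poly K}.
    by rewrite -size_poly_eq0 size_polyDl ?size_polyXn// size_polyN size_polyX.
  have [s es] := closed_field_poly_normal ('X^q - 'X : {poly K}).
  exists s => x xq; rewrite -root_prod_XsubC.
  rewrite -(rootZ _ _ (a := lead_coef ('X^q - 'X))).
    by rewrite -es rootE !hornerE xq subrr.
  by rewrite lead_coef_eq0.
pose row (g : {ffun 'I_N.+1 -> seq_sub s}) : 'rV[K]_N.+1 := \row_j val (g j).
pose h (g : {ffun 'I_N.+1 -> seq_sub s}) : projsp K N :=
  match boolP (row g != 0) with
  | AltTrue r => pt r
  | _ => pt (const_mx1_neq0 K N)
  end.
apply: (@sub_finite_set _ _ (h @` setT)); last exact/finite_image/finite_finset.
move=> x /= /frob_fixed_pt [v [v0 [-> vq _]]].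
have vs j : v 0 j \in s by apply: rs; have /rowP/(_ j) := vq; rewrite mxE.
exists [ffun j => SeqSub (vs j)] => //.
have rowv : row [ffun j => SeqSub (vs j)] = v.
  by apply/rowP => j; rewrite mxE ffunE.
rewrite /h; case: {-}_ / boolP; rewrite rowv.
  by move=> r; apply/ptP; exists 1; rewrite ?oner_neq0 ?scale1r.
by rewrite v0.
Qed.

Lemma sumX_pchar (R : comNzRingType) q (I : finType) (F : I -> R) :
  [pchar R].-nat q -> (\sum_i F i) ^+ q = \sum_i F i ^+ q.
Proof.
move=> qR; apply: (big_morph (fun x => x ^+ q)) => [x y|].
  exact: exprDn_pchar.
by rewrite expr0n; case/andP: qR; case: (q).
Qed.

Section Frobenius.
Variables (K : closedFieldType) (q : nat).
Hypothesis q_pchar : [pchar K].-nat q.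

Let q_gt0 : (0 < q)%N. Proof. by case/andP: q_pchar. Qed.

Lemma expr_inj : injective (fun x : K => x ^+ q).
Proof.
move=> x y /eqP; rewrite -subr_eq0 -exprNn_pchar// -exprDn_pchar//.
by rewrite expf_eq0 subr_eq0 q_gt0 => /eqP.
Qed.

Lemma expr_surj (x : K) : exists y, y ^+ q = x.
Proof.
have [y e] := solve_monicpoly (fun i => if i == 0%N then x else 0) q_gt0.
exists y; rewrite e; case: (q) q_gt0 => // m _.
rewrite big_ord_recl expr0 mulr1 big1 ?addr0// => i _.
by rewrite mul0r.
Qed.

Lemma expmx_inj N : injective (@expmx K N q).
Proof.
move=> v w /rowP e; apply/rowP => i; apply: expr_inj.
by have := e i; rewrite !mxE.
Qed.

Lemma expmxZ N c (v : 'rV[K]_N.+1) : expmx q (c *: v) = c ^+ q *: expmx q v.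
Proof. by apply/rowP => i; rewrite !mxE exprMn. Qed.

Lemma expmx_surj N (v : 'rV[K]_N.+1) : exists w, expmx q w = v.
Proof.
have /choice [f fE] := fun i => expr_surj (v 0 i).
by exists (\row_i f i); apply/rowP => i; rewrite !mxE.
Qed.

Lemma frob_inj N : injective (@frob K N q).
Proof.
move=> x y; elim/pt_ind: x => v v0; elim/pt_ind: y => w w0.
rewrite !frob_pt => /ptP[c c0 e]; apply/ptP; have [d dE] := expr_surj c.
exists d.
  by apply: contra_neq c0 => d0; rewrite -dE d0 expr0n; case: (q) q_gt0.
by apply: (@expmx_inj N); rewrite expmxZ dE.
Qed.

Lemma frob_surj N (x : projsp K N) : exists y, frob q y = x.
Proof.
elim/pt_ind: x => v v0; have [w e] := expmx_surj v.
have w0 : w != 0.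
  apply: contra_neq v0 => w0; rewrite -e w0; apply/rowP => i.
  by rewrite !mxE expr0n; case: (q) q_gt0.
exists (pt w0); rewrite frob_pt; apply/ptP.
by exists 1; rewrite ?oner_neq0// scale1r.
Qed.

End Frobenius.

Definition dual_line (K : fieldType) (a : projsp K 2) : set (projsp K 2) :=
  line_of (val (repr a)).

Section Lines.
Variables (K : fieldType).
Implicit Types (u v w a b : 'rV[K]_3) (x y : projsp K 2).

Definition dot a v := \sum_i a 0 i * v 0 i.

Lemma dotZl c a v : dot (c *: a) v = c * dot a v.
Proof. by rewrite /dot mulr_sumr; apply: eq_bigr => i _; rewrite mxE mulrA. Qed.

Lemma line_of_ptP a v (v0 : v != 0) : line_of a (pt v0) <-> dot a v = 0.
Proof. exact: line_of_pi. Qed.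

Lemma dual_line_pt a (a0 : a != 0) : dual_line (pt a0) = line_of a.
Proof.
have : pt (valP (repr (pt a0))) = pt a0.
  by rewrite -[RHS]reprK /pt; congr (\pi_(_) _)%qT; apply: val_inj.
rewrite /dual_line; move: (valP _) => /=; move: (sval _) => b b0 /ptP[c c0 ->].
apply/seteqP; split=> x; elim/pt_ind: x => v v0 /line_of_ptP H;
  apply/line_of_ptP.
  by rewrite dotZl H mulr0.
by move/eqP: H; rewrite dotZl mulf_eq0 (negPf c0) => /eqP.
Qed.

Lemma dual_lineP a v (a0 : a != 0) (v0 : v != 0) :
  dual_line (pt a0) (pt v0) <-> dot a v = 0.
Proof. by rewrite dual_line_pt; exact: line_of_ptP. Qed.

Lemma is_lineP l : is_line l <-> exists a : projsp K 2, l = dual_line a.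
Proof.
split=> [[a a0 ->]|[a ->]]; first by exists (pt a0); rewrite dual_line_pt.
by elim/pt_ind: a => a a0; exists a => //; rewrite dual_line_pt.
Qed.

Lemma dual_line_inj : injective (@dual_line K).
Proof.
move=> x y; elim/pt_ind: x => a a0; elim/pt_ind: y => b b0 E.
have [i ai0] : exists i, a 0 i != 0 by apply/rV0Pn.
have ab j : a 0 i * b 0 j = a 0 j * b 0 i.
  have [->|ji] := eqVneq j i; first by rewrite mulrC.
  pose v : 'rV[K]_3 := a 0 j *: delta_mx 0 i - a 0 i *: delta_mx 0 j.
  have dotv c : dot c v = a 0 j * c 0 i - a 0 i * c 0 j.
    rewrite /dot (bigD1 i)//= (bigD1 j)//= big1 => [|k /andP[ki kj]].
      rewrite !mxE !eqxx /= (negPf ji) eq_sym (negPf ji).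
      rewrite !mulr0 subr0 sub0r addr0.
      by rewrite !mulr1 mulrN mulrC [c 0 j * _]mulrC.
    by rewrite !mxE (negPf ki) (negPf kj) !mulr0 subr0 mulr0.
  have v0 : v != 0.
    apply: contra_neq ai0 => v0; have /rowP/(_ j) := v0.
    rewrite !mxE !eqxx (negPf ji) mulr0 mulr1 sub0r => /eqP.
    by rewrite oppr_eq0 => /eqP.
  have : dual_line (pt a0) (pt v0).
    by apply/dual_lineP; rewrite dotv mulrC subrr.
  by rewrite E => /dual_lineP; rewrite dotv => /eqP; rewrite subr_eq0 => /eqP.
have be : b = (b 0 i / a 0 i) *: a.
  apply/rowP => j; rewrite mxE; apply: (mulfI ai0).
  by rewrite ab mulrA mulrCA divff// mulr1 mulrC.
apply/ptP; exists (b 0 i / a 0 i) => //.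
by apply/eqP => h; case/eqP: (b0); rewrite be h scale0r.
Qed.

Lemma dual_line_meet (x y a b : projsp K 2) : x <> y ->
  dual_line a x -> dual_line a y -> dual_line b x -> dual_line b y -> a = b.
Proof.
elim/pt_ind: x => u u0; elim/pt_ind: y => v v0.
elim/pt_ind: a => a a0; elim/pt_ind: b => b b0 nuv.
move=> /dual_lineP au /dual_lineP av /dual_lineP bu /dual_lineP bv.
pose M := (col_mx u v)^T.
have kM c : dot c u = 0 -> dot c v = 0 -> (c <= kermx M)%MS.
  move=> cu cv; apply/sub_kermxP; rewrite /M tr_col_mx mul_mx_row.
  have dotE w : c *m w^T = (dot c w)%:M.
    apply/matrixP => i j; rewrite !ord1 !mxE eqxx.
    by apply: eq_bigr => k _; rewrite mxE.
  by rewrite !dotE cu cv raddf0 row_mx0.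
have rM : (1 < \rank M)%N.
  rewrite mxrank_tr -addsmxE ltnNge; apply/negP => r1; apply: nuv.
  have ru := rank_rV u; rewrite u0 /= in ru.
  have := mxrank_leqif_sup (addsmxSl u v); rewrite ru => -[r1' e].
  have : (u + v <= u)%MS by rewrite -e eqn_leq r1 r1'.
  rewrite addsmx_sub => /andP[_ /sub_rVP[c e']]; apply/ptP; exists c => //.
  by apply/eqP => c0; case/eqP: (v0); rewrite e' c0 scale0r.
have ra := rank_rV a; rewrite a0 /= in ra.
have := mxrank_leqif_sup (kM a au av); rewrite ra mxrank_ker => -[r1 e].
have : (kermx M <= a)%MS.
  by rewrite -e eqn_leq r1 leq_subLR addn1 ltnS.
move=> /(submx_trans (kM b bu bv))/sub_rVP[c be]; apply/ptP; exists c => //.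
by apply/eqP => c0; case/eqP: (b0); rewrite be c0 scale0r.
Qed.

End Lines.

Lemma frob_dual_line (K : closedFieldType) (q : nat) (a : projsp K 2) :
  [pchar K].-nat q -> frob q @` dual_line a = dual_line (frob q a).
Proof.
move=> qK; elim/pt_ind: a => a a0; rewrite frob_pt.
have dotX v : dot (expmx q a) (expmx q v) = dot a v ^+ q.
  by rewrite /dot sumX_pchar//; apply: eq_bigr => i _; rewrite !mxE exprMn.
apply/seteqP; split=> [_ [x H <-]|y].
  elim/pt_ind: x H => v v0 /dual_lineP H; rewrite frob_pt; apply/dual_lineP.
  by rewrite dotX H expr0n; case/andP: qK; case: (q).
have [x <-] := frob_surj qK y; elim/pt_ind: x => v v0.
rewrite frob_pt => /dual_lineP/eqP; rewrite dotX expf_eq0 => /andP[_ /eqP H].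
by exists (pt v0); [apply/dual_lineP|rewrite frob_pt].
Qed.

Section LineParametrization.
Variables (K : fieldType) (a : 'rV[K]_3) (i : 'I_3).
Hypothesis ai1 : a 0 i = 1.

Definition embed (w : 'rV[K]_2) : 'rV[K]_3 :=
  \row_j if unlift i j is Some k then w 0 k
         else - \sum_k a 0 (lift i k) * w 0 k.

Lemma embed_lift w k : embed w 0 (lift i k) = w 0 k.
Proof. by rewrite mxE liftK. Qed.

Lemma embed_self w : embed w 0 i = - \sum_k a 0 (lift i k) * w 0 k.
Proof. by rewrite mxE unlift_none. Qed.

Lemma embed_inj : injective embed.
Proof. by move=> v w e; apply/rowP => k; rewrite -!embed_lift e. Qed.

Lemma embedZ c w : embed (c *: w) = c *: embed w.
Proof.
apply/rowP => j; rewrite [RHS]mxE; case: (unliftP i j) => [k|] ->.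
  by rewrite !embed_lift mxE.
rewrite !embed_self mulrN mulr_sumr; congr (- _); apply: eq_bigr => k _.
by rewrite mxE mulrCA.
Qed.

Lemma embed_neq0 w : w != 0 -> embed w != 0.
Proof.
apply: contra_neq => e; apply: embed_inj; rewrite e.
by rewrite -[in RHS](scale0r 0) embedZ scale0r.
Qed.

Lemma dot_lift v : dot a v = v 0 i + \sum_k a 0 (lift i k) * v 0 (lift i k).
Proof. by rewrite /dot (bigD1_ord i)//= ai1 mul1r. Qed.

Lemma dot_embed w : dot a (embed w) = 0.
Proof.
rewrite dot_lift embed_self; under [X in _ + X]eq_bigr do rewrite embed_lift.
by rewrite addNr.
Qed.

Lemma embed_surj v : dot a v = 0 -> exists w, embed w = v.
Proof.
rewrite dot_lift => /eqP; rewrite addr_eq0 => /eqP e.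
exists (\row_k v 0 (lift i k)); apply/rowP => j.
case: (unliftP i j) => [k|] ->; first by rewrite embed_lift mxE.
by rewrite embed_self e; congr (- _); apply: eq_bigr => k _; rewrite mxE.
Qed.

Lemma embed_expmx q w : [pchar K].-nat q -> expmx q a = a ->
  embed (expmx q w) = expmx q (embed w).
Proof.
move=> qK /rowP aq; apply/rowP => j; rewrite [RHS]mxE.
case: (unliftP i j) => [k|] ->; first by rewrite !embed_lift mxE.
rewrite !embed_self exprNn_pchar// sumX_pchar//; congr (- _).
apply: eq_bigr => k _; rewrite exprMn mxE; congr (_ * _).
by have := aq (lift i k); rewrite !mxE.
Qed.

End LineParametrization.

(* A Frobenius-fixed line can be scaled to have Frobenius-fixed coefficients, one
   of them 1; solving for the corresponding coordinate parametrizes the line. *)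
Lemma fixed_line_param (K : fieldType) q (a : projsp K 2) :
  [pchar K].-nat q -> frob q a = a ->
  exists phi : projsp K 1 -> projsp K 2,
    [/\ injective phi, range phi = dual_line a &
        forall w, phi (frob q w) = frob q (phi w)].
Proof.
move=> qK /frob_fixed_pt[v [v0 [-> vq [i vi]]]].
pose phi (x : projsp K 1) := pt (embed_neq0 v i (valP (repr x))).
have phi_pt w (w0 : w != 0) : phi (pt w0) = pt (embed_neq0 v i w0).
  have : pt (valP (repr (pt w0))) = pt w0.
    by rewrite -[RHS]reprK /pt; congr (\pi_(_) _)%qT; apply: val_inj.
  by move=> /ptP[c c0 e]; apply/ptP; exists c; rewrite // -embedZ -e.
exists phi; split.
- move=> x y; elim/pt_ind: x => w w0; elim/pt_ind: y => z z0.
  rewrite !phi_pt => /ptP[c c0]; rewrite -embedZ => /embed_inj e.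
  by apply/ptP; exists c.
- apply/seteqP; split=> [_ [x _ <-]|x].
    by elim/pt_ind: x => w w0; rewrite phi_pt; apply/dual_lineP/dot_embed.
  elim/pt_ind: x => u u0 /dual_lineP /(embed_surj vi)[w e].
  have w0 : w != 0.
    apply: contra_neq u0 => w0; rewrite -e w0.
    by rewrite -(scale0r 0) embedZ scale0r.
  exists (pt w0) => //; rewrite phi_pt; apply/ptP.
  by exists 1; rewrite ?oner_neq0// scale1r e.
- elim/pt_ind=> w w0; rewrite frob_pt !phi_pt frob_pt; apply/ptP.
  by exists 1; rewrite ?oner_neq0// scale1r embed_expmx.
Qed.

(** * Counting points on lines *)

Section Points.
Variables (K : closedFieldType) (q : nat).
Hypotheses (q_gt1 : (1 < q)%N) (q_pchar : [pchar K].-nat q).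

Lemma qpointsP N n x : qpoints K N q n x <->
  [/\ (0 < n)%N, iter n (frob q) x = x &
      forall m, (0 < m < n)%N -> iter m (frob q) x <> x].
Proof. exact: (orbit_sizeP (@frob_inj _ _ q_pchar N)). Qed.

Lemma finite_qpoints N n : finite_set (qpoints K N q n).
Proof.
have [->|n0] := posnP n.
  by rewrite (_ : qpoints _ _ _ _ = set0)// -subset0 => x /qpointsP[].
apply: (sub_finite_set _ (@finite_frob_fixed K N (q ^ n) _)).
  by move=> x /qpointsP[_ e _] /=; rewrite -iter_frob.
by rewrite -(exp1n n) ltn_exp2r.
Qed.

End Points.

Section Counting.
Variables (K : closedFieldType) (q : nat).
Hypotheses (q_gt1 : (1 < q)%N) (q_pchar : [pchar K].-nat q).

Let qX_pchar r : [pchar K].-nat (q ^ r)%N.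
Proof. by rewrite pnatX q_pchar. Qed.

Let f_inj N := @frob_inj K q q_pchar N.
Let F := fun m : set (projsp K 2) => frob q @` m.

Lemma image_frob_inj : injective F.
Proof.
move=> A B e; apply/seteqP; split=> x.
  by rewrite -(image_inj (@f_inj 2)) -/(F A) e => -[y By /f_inj <-].
by rewrite -(image_inj (@f_inj 2)) -/(F B) -e => -[y By /f_inj <-].
Qed.

Lemma iter_image_frob_dual_line r a :
  iter r F (dual_line a) = dual_line (frob (q ^ r) a).
Proof.
rewrite -iter_frob; elim: r => [//|r IH] /=.
by rewrite IH /F frob_dual_line.
Qed.

Lemma iter_image_frob_mem r (l : set (projsp K 2)) x :
  l x -> iter r F l (iter r (frob q) x).
Proof. by move=> lx; elim: r => [//|r IH] /=; exists (iter r (frob q) x). Qed.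

Lemma qlinesP r l : qlines K q r l -> exists2 a, l = dual_line a &
  frob (q ^ r) a = a.
Proof.
case=> /is_lineP[a ->] /(orbit_sizeP image_frob_inj)[_ e _]; exists a => //.
by apply: dual_line_inj; rewrite -iter_image_frob_dual_line.
Qed.

Lemma finite_qlines r : (0 < r)%N -> finite_set (qlines K q r).
Proof.
move=> r0.
apply: (@sub_finite_set _ _ (@dual_line K @` [set a | frob (q ^ r) a = a])).
  by move=> l /qlinesP[a -> e]; exists a.
apply/finite_image/finite_frob_fixed.
by rewrite -(exp1n r) ltn_exp2r.
Qed.

Lemma line_eq_of_shared_point r l m x : is_line l -> is_line m ->
  iter r F l = l -> iter r F m = m -> iter r (frob q) x <> x ->
  l x -> m x -> l = m.
Proof.
move=> /is_lineP[a ->] /is_lineP[b ->] la lb nx ax bx; congr dual_line.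
apply: (dual_line_meet nx) => //.
  by rewrite -la; apply: iter_image_frob_mem.
by rewrite -lb; apply: iter_image_frob_mem.
Qed.

Lemma qlines_coprime_point r n l x : coprime r n -> (r < n)%N ->
  qlines K q r l -> qpoints K 2 q n x -> l x -> r = 1%N.
Proof.
move=> crn rn [Ll /(orbit_sizeP image_frob_inj)[r0 e lmin]].
move=> /(qpointsP q_pchar)[n0 xn xmin] lx.
apply/eqP; rewrite eqn_leq r0 andbT leqNgt; apply/negP => r1.
case: (lmin 1%N) => //=.
have LF : is_line (F l).
  have /is_lineP[a ->] := Ll; apply/is_lineP; exists (frob q a).
  exact: frob_dual_line.
have lfx : l (frob q x).
  have [j <-] := iter_coprime r0 crn xn.
  by rewrite -(iter_mul_fixed j e); apply: iter_image_frob_mem.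
apply: (@line_eq_of_shared_point r _ _ (frob q x)) => //.
- by rewrite -iterSr iterS e.
- by rewrite -iterSr iterS => /f_inj; apply: xmin; rewrite r0.
- by exists x.
Qed.

Lemma qline_points r l : qlines K q r l ->
  exists2 phi : projsp K 1 -> projsp K 2, injective phi &
    forall n, phi @` qpoints K 1 (q ^ r) n = qpoints K 2 (q ^ r) n `&` l.
Proof.
move=> /qlinesP[a -> e].
have [phi [phiI <- phiF]] := fixed_line_param (qX_pchar r) e.
exists phi => // n.
have it m w : iter m (frob (q ^ r)) (phi w) = phi (iter m (frob (q ^ r)) w).
  by elim: m => [//|m IH] /=; rewrite IH phiF.
have orb w : qpoints K 1 (q ^ r) n w <-> qpoints K 2 (q ^ r) n (phi w).
  split=> /(qpointsP (qX_pchar r))[n0 en mn];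
    apply/(qpointsP (qX_pchar r)); split => //.
  - by rewrite it en.
  - by move=> m /mn nm; rewrite it => /phiI.
  - by apply: phiI; rewrite -it.
  - by move=> m /mn; rewrite it => nm em; apply: nm; rewrite em.
apply/seteqP; split=> [_ [w wn <-]|x [xn [w _ wx]]].
  by split; [apply/orb|exists w].
by exists w => //; apply/orb; rewrite wx.
Qed.

Lemma ncard_points_on_qlines r n m :
  (0 < r)%N -> (r < n)%N ->
  (forall l, qlines K q r l ->
     qpoints K 2 q n `&` l = qpoints K 2 (q ^ r) m `&` l) ->
  ncard (\bigcup_(l in qlines K q r) (qpoints K 2 q n `&` l)) =
  (ncard (qlines K q r) * ncard (qpoints K 1 (q ^ r) m))%N.
Proof.
move=> r0 rn nm.
have /choice[phi phiP] : forall l, exists phi : projsp K 1 -> projsp K 2,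
    qlines K q r l -> injective phi /\
      phi @` qpoints K 1 (q ^ r) m = qpoints K 2 q n `&` l.
  move=> l.
  have [/[dup] Ll /qline_points[phi I E]|nl] := pselect (qlines K q r l).
    by exists phi; rewrite nm.
  by exists (fun _ => pt (const_mx1_neq0 K 2)).
apply: (@ncard_fibered _ _ _ _ _ phi _ (fun l => qpoints K 2 q n `&` l)) => //.
- exact: finite_qlines.
- by apply: finite_qpoints; rewrite // -(exp1n r) ltn_exp2r.
- by move=> l /phiP[I _] x y _ _; apply: I.
- by move=> l /phiP[].
move=> l l' x [Ll /(orbit_sizeP image_frob_inj)[_ e _]].
move=> [Ll' /(orbit_sizeP image_frob_inj)[_ e' _]].
move=> [/(qpointsP q_pchar)[_ _ xmin] lx] [_ lx'].
by apply: (line_eq_of_shared_point Ll Ll' e e') lx lx'; apply: xmin; rewrite r0.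
Qed.

Lemma qgenericE n : qgeneric K q n = qpoints K 2 q n `\`
   \bigcup_(r in [set r | (r < if odd n then n else n./2)%N])
   \bigcup_(l in qlines K q r) (qpoints K 2 q n `&` l).
Proof.
apply/seteqP; split=> x [xn H]; split=> //.
  by move=> [r rn [l lr [_ lx]]]; apply: (H r l).
by move=> r l rn lr lx; apply: H; exists r => //; exists l.
Qed.

End Counting.

Section Generic.
Variables (K : closedFieldType) (q : nat).
Hypotheses (q_gt1 : (1 < q)%N) (q_pchar : [pchar K].-nat q).

Definition on_qlines n r := \bigcup_(l in qlines K q r) (qpoints K 2 q n `&` l).

Lemma qlines0 : qlines K q 0 = set0.
Proof.
by rewrite -subset0 => l [_ /(orbit_sizeP (image_frob_inj q_pchar))[]].
Qed.

Lemma sub_on_qlines n r : on_qlines n r `<=` qpoints K 2 q n.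
Proof. by move=> x [l _ []]. Qed.

Lemma ncard_on_qlines1 n : (1 < n)%N ->
  ncard (on_qlines n 1) = (ncard (qlines K q 1) * ncard (qpoints K 1 q n))%N.
Proof.
by move=> n1; rewrite (@ncard_points_on_qlines _ _ q_gt1 q_pchar 1 n n)// expn1.
Qed.

Lemma qpoints6_on_qline2 l : qlines K q 2 l ->
  qpoints K 2 q 6 `&` l = qpoints K 2 (q ^ 2) 3 `&` l.
Proof.
move=> Ll; apply/seteqP; split=> x [xn lx]; split=> //.
  apply/qpointsP; first by rewrite pnatX q_pchar.
  move/(qpointsP q_pchar): xn => [_ x6 xmin].
  have it m : iter m (frob (q ^ 2)) x = iter (m * 2) (frob q) x.
    by rewrite !iter_frob -expnM mulnC.
  split=> //; first by rewrite it.
  move=> m /andP[m0 m3]; rewrite it; apply: xmin.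
  by rewrite muln_gt0 m0 -[6%N]/(3 * 2)%N ltn_pmul2r.
move: xn => /qpointsP; rewrite pnatX q_pchar => /(_ isT)[_].
rewrite iter_frob -expnM -iter_frob => x6 xmin.
have x2 : iter 2 (frob q) x <> x by rewrite iter_frob; exact: (xmin 1%N).
have x4 : iter 4 (frob q) x <> x.
  by have := xmin 2%N isT; rewrite iter_frob -expnM -iter_frob.
have x1 : frob q x <> x by move=> e; apply: x2; rewrite /= !e.
apply/(qpointsP q_pchar); split=> // -[|[|[|[|[|[|m]]]]]] // _ xm.
- have x3 : qpoints K 2 q 3 x.
    by apply/(qpointsP q_pchar); split=> // -[|[|[|m]]].
  by have := qlines_coprime_point q_pchar (isT : coprime 2 3) isT Ll x3 lx.
- by apply: x1; rewrite -[RHS]x6 iterS xm.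
Qed.

Lemma ncard_on_qlines2 :
  ncard (on_qlines 6 2) =
  (ncard (qlines K q 2) * ncard (qpoints K 1 (q ^ 2) 3))%N.
Proof. exact: ncard_points_on_qlines qpoints6_on_qline2. Qed.

Lemma on_qlines1_2_disj x : on_qlines 6 1 x -> ~ on_qlines 6 2 x.
Proof.
move=> [l [Ll /(orbit_sizeP (image_frob_inj q_pchar))[_ e _]] [xn lx]].
move=> [m [Lm /(orbit_sizeP (image_frob_inj q_pchar))[_ e' mmin]] [_ mx]].
apply: (mmin 1%N) => //; suff <- : l = m by [].
move/(qpointsP q_pchar): xn => [_ _ xmin].
apply: (@line_eq_of_shared_point _ q 2 _ _ x) => //; last exact: xmin.
exact: (iter_mul_fixed 2 e).
Qed.

Lemma qgeneric_lt6 n : (3 <= n < 6)%N ->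
  qgeneric K q n = qpoints K 2 q n `\` on_qlines n 1.
Proof.
move=> n36; rewrite qgenericE; congr (_ `\` _).
apply/seteqP; split=> x; last first.
  by exists 1%N => //=; move: n n36 {H} => [|[|[|[|[|[|]]]]]].
move=> [r /= rn [l Ll [xn lx]]]; suff r1 : r = 1%N by exists l; rewrite -?r1.
case: r rn Ll => [|[//|r]] rn Ll; first by rewrite qlines0 in Ll.
have rn' : (r.+2 < n)%N && coprime r.+2 n.
  by move: n n36 rn {xn} => [|[|[|[|[|[|]]]]]]//; case: r {Ll} => [|[|[|]]].
case/andP: rn' => lt co.
by rewrite (qlines_coprime_point q_pchar co lt Ll xn lx).
Qed.

Lemma qgeneric_6 :
  qgeneric K q 6 = qpoints K 2 q 6 `\` (on_qlines 6 1 `|` on_qlines 6 2).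
Proof.
rewrite qgenericE; congr (_ `\` _); apply/seteqP; split=> x.
  move=> [[|[|[|//]]] /= _]; last by right.
    by rewrite qlines0 bigcup_set0.
  by left.
by case=> H; [exists 1%N|exists 2%N].
Qed.

End Generic.

Theorem proposition4p7 (p k q : nat) (hp : prime p) (hk : (0 < k)%N)
    (hq : q = (p ^ k)%N)
    (Fq : finFieldType) (hF : #|Fq| = q)
    (K : closedFieldType) (iota : {rmorphism Fq -> K})
    (hK : integralRange iota) :
  (forall n : nat, (3 <= n < 6)%N ->
     (ncard (qgeneric K q n))%:Z =
       (ncard (qpoints K 2 q n))%:Z
       - (ncard (qlines K q 1))%:Z * (ncard (qpoints K 1 q n))%:Z) /\
  (ncard (qgeneric K q 6))%:Z =
    (ncard (qpoints K 2 q 6))%:Z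
    - (ncard (qlines K q 1))%:Z * (ncard (qpoints K 1 q 6))%:Z
    - (ncard (qlines K q 2))%:Z * (ncard (qpoints K 1 (q ^ 2) 3))%:Z.
Proof.
have q1 : (1 < q)%N by rewrite hq -(exp1n k) ltn_exp2r// prime_gt1.
have qK : [pchar K].-nat q.
  have pF : p \in [pchar Fq].
    by apply: (@card_finPcharP _ _ k) => //; rewrite hF.
  by rewrite hq pnatX pnatE// (rmorph_pchar iota pF).
have fin n := finite_qpoints q1 qK 2 n.
have sub n r := @sub_on_qlines K q n r.
split=> [n /[dup] n36 /andP[n3 _]|].
  rewrite qgeneric_lt6// ncard_setDS// ncard_on_qlines1 ?PoszM//.
  exact: leq_trans n3.
rewrite qgeneric_6// ncard_setDS//; last by move=> x [|] /sub.
rewrite ncard_setU_disj; [|exact: sub_finite_set (sub 6 1) (fin 6)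
  |exact: sub_finite_set (sub 6 2) (fin 6)|exact: on_qlines1_2_disj].
by rewrite ncard_on_qlines1// ncard_on_qlines2// PoszD !PoszM opprD addrA.
Qed.
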